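(* Let $G$ be an ordered groupoid. Then the ordered groupoid $J(\mathbf{R}(G),R(G))$ is isomorphic to $G$ (as an ordered groupoid).
   Context: A category is regarded as a (small) set of arrows with a partial product; $C_o$ is its set of identities, $\mathbf{d}(x)$ and $\mathbf{r}(x)$ are the domain and range identities of $x$, and $xy$ is defined (written $\exists xy$) iff $\mathbf{d}(x)=\mathbf{r}(y)$. An ordered groupoid is a groupoid $G$ with a partial order $\leq$ on the set $G$ such that: (i) $x\leq y$ implies $x^{-1}\leq y^{-1}$; (ii) if $x\leq y$, $u\leq v$, $\exists xu$ and $\exists yv$ then $xu\leq yv$; (iii) if $e$ is an identity with $e\leq\mathbf{d}(x)$ then there is a unique element $(x\,|\,e)\leq x$ with $\mathbf{d}(x\,|\,e)=e$; (iv) if $e$ is an identity with $e\leq\mathbf{r}(x)$ then there is a unique element $(e\,|\,x)\leq x$ with $\mathbf{r}(e\,|\,x)=e$. An isomorphism of ordered groupoids is a bijective order-preserving functor whose inverse is an order-preserving functor. If $e=\mathbf{d}(x)\wedge\mathbf{r}(y)$ exists in $G_o$, the pseudoproduct is $x\otimes y=(x\,|\,e)(e\,|\,y)$. The category $\mathbf{R}(G)$: elements are pairs $(x,e)\in G\times G_o$ with $\mathbf{d}(x)\leq e$; $\mathbf{d}(x,e)=(e,e)$, $\mathbf{r}(x,e)=(\mathbf{r}(x),\mathbf{r}(x))$; if $e=\mathbf{r}(y)$ then $(x,e)(y,f)=(x\otimes y,f)$. The principal groupoid $R(G)$: elements are pairs $(x,y)\in G\times G$ with $\mathbf{r}(x)=\mathbf{r}(y)$;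 $\mathbf{d}(x,y)=(y,y)$, $\mathbf{r}(x,y)=(x,x)$, $(x,y)(y,z)=(x,z)$. The action of $\mathbf{R}(G)$ on $R(G)$: $\pi:R(G)\to\mathbf{R}(G)_o$ is $\pi(x,y)=(\mathbf{r}(x),\mathbf{r}(y))$, and $(g,e)\cdot(x,y)=(g\otimes x,g\otimes y)$, defined iff $e=\mathbf{r}(x)=\mathbf{r}(y)$. For such an action of a category $C$ on a principal groupoid $H$: $x\preceq y$ in $H$ iff $x=a\cdot y$ for some $a\in C$, and $x\equiv y$ iff $x\preceq y$ and $y\preceq x$. $J(C,H)$ is the set of $\equiv$-classes $[x]$, ordered by $[x]\leq[y]$ iff $x\preceq y$, with $\mathbf{d}[x]=[\mathbf{d}(x)]$, $\mathbf{r}[x]=[\mathbf{r}(x)]$, and partial product defined exactly when $\mathbf{d}[x]=\mathbf{r}[y]$ by $[x][y]=[x'y']$ where $x'\in[x]$, $y'\in[y]$ and $\exists x'y'$. *)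

(* Defs.v *)
From Stdlib Require Import Relations.
From Stdlib Require Import FunctionalExtensionality PropExtensionality ProofIrrelevance.

Set Implicit Arguments.
Unset Strict Implicit.
Unset Printing Implicit Defensive.

(** [comp x y z] reads: the product [xy] is defined and equal to [z].  The
    convention is that [xy] is defined iff [dom x = ran y]. *)
Record cat_data := CatData {
  arr :> Type;
  dom : arr -> arr;
  ran : arr -> arr;
  comp : arr -> arr -> arr -> Prop
}.

Definition is_identity (C : cat_data) (e : C) : Prop := dom e = e.

Record is_category (C : cat_data) : Prop := {
  comp_fun : forall x y z z' : C, comp x y z -> comp x y z' -> z = z';
  comp_ex : forall x y : C, (exists z, comp x y z) <-> dom x = ran y;
  dom_dom : forall x : C, dom (dom x) = dom x;
  ran_dom : forall x : C, ran (dom x) = dom x;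
  dom_ran : forall x : C, dom (ran x) = ran x;
  ran_ran : forall x : C, ran (ran x) = ran x;
  comp_dom : forall x : C, comp x (dom x) x;
  comp_ran : forall x : C, comp (ran x) x x;
  dom_comp : forall x y z : C, comp x y z -> dom z = dom y;
  ran_comp : forall x y z : C, comp x y z -> ran z = ran x;
  comp_assoc : forall x y z u v w : C,
    comp x y u -> comp y z v -> (comp u z w <-> comp x v w)
}.

(** Inverses are not part of the data; in a category they are unique. *)
Definition is_inverse (C : cat_data) (x x' : C) : Prop :=
  comp x' x (dom x) /\ comp x x' (ran x).

Definition is_groupoid (C : cat_data) : Prop :=
  is_category C /\ forall x : C, exists x' : C, is_inverse x x'.

Definition is_principal_groupoid (C : cat_data) : Prop :=
  is_groupoid C /\
  forall x y : C, dom x = dom y -> ran x = ran y -> x = y.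

Record category := Category {
  category_data :> cat_data;
  categoryP : is_category category_data
}.

Record principal_groupoid := PrincipalGroupoid {
  principal_groupoid_data :> cat_data;
  principal_groupoidP : is_principal_groupoid principal_groupoid_data
}.

Record ordered_data := OrderedData {
  ordered_cat_data :> cat_data;
  le : relation ordered_cat_data
}.

Definition is_restriction (G : ordered_data) (x e u : G) : Prop :=
  le u x /\ dom u = e.

Definition is_corestriction (G : ordered_data) (e x u : G) : Prop :=
  le u x /\ ran u = e.

Record is_ordered_groupoid (G : ordered_data) : Prop := {
  og_groupoid : is_groupoid G;
  og_order : order G (@le G);
  og_inv : forall x y x' y' : G,
    is_inverse x x' -> is_inverse y y' -> le x y -> le x' y';
  og_comp : forall x y u v p q : G,
    le x y -> le u v -> comp x u p -> comp y v q -> le p q;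
  og_restr : forall x e : G, is_identity e -> le e (dom x) ->
    exists! u : G, is_restriction x e u;
  og_corestr : forall x e : G, is_identity e -> le e (ran x) ->
    exists! u : G, is_corestriction e x u
}.

Record ordered_groupoid := OrderedGroupoid {
  ordered_groupoid_data :> ordered_data;
  ordered_groupoidP : is_ordered_groupoid ordered_groupoid_data
}.

Record is_functor (C D : cat_data) (f : C -> D) : Prop := {
  functor_dom : forall x, f (dom x) = dom (f x);
  functor_ran : forall x, f (ran x) = ran (f x);
  functor_comp : forall x y z, comp x y z -> comp (f x) (f y) (f z)
}.

Definition order_preserving (G K : ordered_data) (f : G -> K) : Prop :=
  forall x y, le x y -> le (f x) (f y).

Definition isomorphic (G K : ordered_data) : Prop :=
  exists (f : G -> K) (g : K -> G),
    (forall x, g (f x) = x) /\ (forall y, f (g y) = y) /\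
    is_functor f /\ order_preserving f /\
    is_functor g /\ order_preserving g.

Definition is_identity_meet (G : ordered_data) (a b e : G) : Prop :=
  is_identity e /\ le e a /\ le e b /\
  forall f : G, is_identity f -> le f a -> le f b -> le f e.

(** [pseudoproduct x y z] reads: the pseudoproduct of [x] and [y] is defined
    and equal to [z]. *)
Definition pseudoproduct (G : ordered_data) (x y z : G) : Prop :=
  exists e u v : G, is_identity_meet (dom x) (ran y) e /\
    is_restriction x e u /\ is_corestriction e y v /\ comp u v z.

(** [act a x y] reads: [a . x] is defined and equal to [y].  The category acts
    by functors: each [a] carries the part of [H] over [dom a] to the part
    over [ran a]. *)
Record action (C : category) (H : principal_groupoid) := Action {
  proj : H -> C;
  act : C -> H -> H -> Prop;
  proj_id : forall x, is_identity (proj x);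
  proj_dom : forall x, proj (dom x) = proj x;
  proj_ran : forall x, proj (ran x) = proj x;
  act_fun : forall a x y y', act a x y -> act a x y' -> y = y';
  act_ex : forall a x, (exists y, act a x y) <-> dom a = proj x;
  act_proj : forall x, act (proj x) x x;
  proj_act : forall a x y, act a x y -> proj y = ran a;
  act_comp : forall a b c x y z,
    comp a b c -> act b x y -> (act c x z <-> act a y z);
  act_dom : forall a x y, act a x y -> act a (dom x) (dom y);
  act_ran : forall a x y, act a x y -> act a (ran x) (ran y);
  act_prod : forall a x y z x' y' z', comp x y z ->
    act a x x' -> act a y y' -> act a z z' -> comp x' y' z'
}.

Section J.
Variables (C : category) (H : principal_groupoid) (A : action C H).

Definition act_le (x y : H) : Prop := exists a : C, act A a y x.
Definition act_equiv (x y : H) : Prop := act_le x y /\ act_le y x.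

Lemma act_le_refl x : act_le x x.
Proof. exists (proj A x); apply act_proj. Qed.

Lemma act_le_trans x y z : act_le x y -> act_le y z -> act_le x z.
Proof.
intros [a ha] [b hb].
assert (hd : dom a = ran b).
{ rewrite <- (proj_act hb). apply (act_ex A). now exists x. }
apply (comp_ex (categoryP C)) in hd. destruct hd as [c hc].
exists c. now apply (act_comp x hc hb).
Qed.

Lemma act_equiv_equivalence : equivalence H act_equiv.
Proof.
split.
- intro x; split; apply act_le_refl.
- intros x y z [h1 h2] [h3 h4]; split; eapply act_le_trans; eassumption.
- intros x y [h1 h2]; now split.
Qed.

Definition act_class : Type :=
  {X : H -> Prop | exists x, X = fun y => act_equiv y x}.

Definition class_mem (X : act_class) (x : H) : Prop := proj1_sig X x.

Definition class_of (x : H) : act_class :=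
  exist _ (fun y => act_equiv y x) (ex_intro _ x eq_refl).

Lemma class_ext (X Y : act_class) :
  (forall x, class_mem X x <-> class_mem Y x) -> X = Y.
Proof.
destruct X as [X hX], Y as [Y hY]; simpl; intro h.
apply subset_eq_compat.
apply functional_extensionality; intro x; apply propositional_extensionality.
apply h.
Qed.

Lemma class_of_surj (X : act_class) : exists x, X = class_of x.
Proof.
destruct X as [X [x hX]]; exists x; subst X; reflexivity.
Qed.

Lemma class_of_eq x y : class_of x = class_of y <-> act_equiv x y.
Proof.
destruct act_equiv_equivalence as [er et es]. split.
- intro h. change (class_mem (class_of y) x). rewrite <- h. apply er.
- intro h; apply class_ext; intro z; unfold class_mem; simpl; split; intro h'.
  + exact (et _ _ _ h' h).
  + exact (et _ _ _ h' (es _ _ h)).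
Qed.

Section Lift.
Variables (f : H -> H) (fP : forall x y, act_equiv x y -> act_equiv (f x) (f y)).

Lemma lift_subproof (X : act_class) :
  exists x, (fun z => exists y, class_mem X y /\ act_equiv z (f y)) =
            (fun z => act_equiv z x).
Proof.
destruct (class_of_surj X) as [x ->]; exists (f x).
destruct act_equiv_equivalence as [er et es].
apply functional_extensionality; intro z; apply propositional_extensionality.
split.
- intros [y [hy hz]]. exact (et _ _ _ hz (fP hy)).
- intro hz; exists x; split; [apply er | exact hz].
Qed.

Definition class_lift (X : act_class) : act_class :=
  exist _ (fun z => exists y, class_mem X y /\ act_equiv z (f y))
    (lift_subproof X).

Lemma class_lift_of x : class_lift (class_of x) = class_of (f x).
Proof.
destruct act_equiv_equivalence as [er et es].
apply class_ext; intro z; unfold class_mem; simpl; split.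
- intros [y [hy hz]]. exact (et _ _ _ hz (fP hy)).
- intro hz; exists x; split; [apply er | exact hz].
Qed.
End Lift.

Lemma act_equiv_dom x y : act_equiv x y -> act_equiv (dom x) (dom y).
Proof.
intros [[a ha] [b hb]]; split; [exists a | exists b]; now apply act_dom.
Qed.

Lemma act_equiv_ran x y : act_equiv x y -> act_equiv (ran x) (ran y).
Proof.
intros [[a ha] [b hb]]; split; [exists a | exists b]; now apply act_ran.
Qed.

(** This is only data: that it is an ordered groupoid (in particular that the
    product of classes is single-valued, and defined iff [dom X = ran Y]) needs
    more than the laws of [action]. *)
Definition J : ordered_data :=
  @OrderedData
    (@CatData act_class (class_lift act_equiv_dom) (class_lift act_equiv_ran)
      (fun X Y Z => exists x y z,
        class_mem X x /\ class_mem Y y /\ comp x y z /\ Z = class_of z))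
    (fun X Y => exists x y, X = class_of x /\ Y = class_of y /\ act_le x y).

Lemma dom_class_of x : dom (class_of x : J) = class_of (dom x).
Proof. apply class_lift_of. Qed.

Lemma ran_class_of x : ran (class_of x : J) = class_of (ran x).
Proof. apply class_lift_of. Qed.

Lemma le_class_of x y : le (class_of x : J) (class_of y : J) <-> act_le x y.
Proof.
split.
- intros [x' [y' [hx [hy h]]]].
  apply class_of_eq in hx; apply class_of_eq in hy.
  exact (act_le_trans (proj1 hx) (act_le_trans h (proj2 hy))).
- intro h; now exists x, y.
Qed.
End J.

Section Constructions.
Variable G : ordered_groupoid.

Let GP := ordered_groupoidP G.
Let GC : is_category G := proj1 (og_groupoid GP).

Lemma og_le_refl (x : G) : le x x.
Proof. apply (ord_refl _ _ (og_order GP)). Qed.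

Lemma og_le_trans (x y z : G) : le x y -> le y z -> le x z.
Proof. apply (ord_trans _ _ (og_order GP)). Qed.

Lemma og_le_dom (x y : G) : le x y -> le (dom x) (dom y).
Proof.
intro h.
destruct (proj2 (og_groupoid GP) x) as [x' hx].
destruct (proj2 (og_groupoid GP) y) as [y' hy].
exact (og_comp GP (og_inv GP hx hy h) h (proj1 hx) (proj1 hy)).
Qed.

Lemma og_restriction_eq (x u v : G) :
  le u x -> le v x -> dom u = dom v -> u = v.
Proof.
intros hu hv e.
destruct (og_restr GP (x := x) (e := dom v)) as [w [_ hw]].
- apply (dom_dom GC).
- now apply og_le_dom.
- rewrite <- (hw u (conj hu e)). exact (hw v (conj hv eq_refl)).
Qed.

Lemma og_le_ran (x y : G) : le x y -> le (ran x) (ran y).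
Proof.
intro h.
destruct (proj2 (og_groupoid GP) x) as [x' hx].
destruct (proj2 (og_groupoid GP) y) as [y' hy].
exact (og_comp GP h (og_inv GP hx hy h) (proj2 hx) (proj2 hy)).
Qed.

Lemma og_corestriction_eq (x u v : G) :
  le u x -> le v x -> ran u = ran v -> u = v.
Proof.
intros hu hv e.
destruct (og_corestr GP (x := x) (e := ran v)) as [w [_ hw]].
- apply (dom_ran GC).
- now apply og_le_ran.
- rewrite <- (hw u (conj hu e)). exact (hw v (conj hv eq_refl)).
Qed.

Lemma pseudoproduct_le (x y z : G) : le (dom x) (ran y) ->
  (pseudoproduct x y z <-> exists v, le v y /\ ran v = dom x /\ comp x v z).
Proof.
intro h; split.
- intros [e [u [v [[ide [l1 [l2 l3]]] [[l4 d4] [[l5 d5] hc]]]]]].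
  assert (he : e = dom x).
  { apply (ord_antisym _ _ (og_order GP)); [exact l1|].
    apply l3; [apply (dom_dom GC) | apply og_le_refl | exact h]. }
  subst e.
  assert (hu : u = x).
  { apply (og_restriction_eq l4 (og_le_refl x)). exact he. }
  subst u. exists v; repeat split; trivial.
- intros [v [l [e hc]]].
  exists (dom x), x, v; repeat split; trivial.
  + apply (dom_dom GC).
  + apply og_le_refl.
  + apply og_le_refl.
Qed.

Lemma pseudoproduct_fun (x y z z' : G) : le (dom x) (ran y) ->
  pseudoproduct x y z -> pseudoproduct x y z' -> z = z'.
Proof.
intros h h1 h2.
apply (pseudoproduct_le _ h) in h1; apply (pseudoproduct_le _ h) in h2.
destruct h1 as [v [l [e hc]]], h2 as [v' [l' [e' hc']]].
assert (v = v') by (apply (og_corestriction_eq l l'); congruence).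
subst v'. exact (comp_fun GC hc hc').
Qed.

Lemma pseudoproduct_ex (x y : G) : le (dom x) (ran y) ->
  exists z, pseudoproduct x y z.
Proof.
intro h.
destruct (og_corestr GP (x := y) (e := dom x) (dom_dom GC x) h)
  as [v [[l e] _]].
destruct (proj2 (comp_ex GC x v) (eq_sym e)) as [z hz].
exists z. apply (pseudoproduct_le _ h). now exists v.
Qed.

Lemma pseudoproduct_dom (x y z : G) :
  pseudoproduct x y z -> le (dom z) (dom y).
Proof.
intros [e [u [v [_ [_ [[l _] hc]]]]]].
rewrite (dom_comp GC hc). now apply og_le_dom.
Qed.

Lemma pseudoproduct_ran (x y z : G) : le (dom x) (ran y) ->
  pseudoproduct x y z -> ran z = ran x.
Proof.
intros h hp; apply (pseudoproduct_le _ h) in hp.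
destruct hp as [v [_ [_ hc]]]. exact (ran_comp GC hc).
Qed.

Lemma pseudoproduct_assoc (x y z u v w : G) :
  le (dom x) (ran y) -> le (dom y) (ran z) ->
  pseudoproduct x y u -> pseudoproduct y z v ->
  (pseudoproduct u z w <-> pseudoproduct x v w).
Proof.
intros h1 h2 hu hv.
assert (h3 : le (dom u) (ran z))
  by exact (og_le_trans (pseudoproduct_dom hu) h2).
assert (h4 : le (dom x) (ran v)) by now rewrite (pseudoproduct_ran h2 hv).
assert (key : forall w, pseudoproduct u z w -> pseudoproduct x v w).
{ clear w; intros w hw.
  apply (pseudoproduct_le _ h1) in hu. apply (pseudoproduct_le _ h2) in hv.
  apply (pseudoproduct_le _ h3) in hw. apply (pseudoproduct_le _ h4).
  destruct hu as [y1 [ly [ey hu]]], hv as [z1 [lz [ez hv]]].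
  destruct hw as [z2 [lz2 [ez2 hw]]].
  assert (ed : dom y1 = ran z2) by (rewrite ez2; symmetry; exact (dom_comp GC hu)).
  destruct (proj2 (comp_ex GC y1 z2) ed) as [p hp].
  assert (l2 : le z2 z1).
  { assert (l : le (ran z2) (ran z1)).
    { rewrite ez, <- ed. now apply og_le_dom. }
    destruct (og_corestr GP (x := z1) (e := ran z2) (dom_ran GC z2) l)
      as [t [[lt et] _]].
    rewrite <- (og_corestriction_eq (og_le_trans lt lz) lz2 et). exact lt. }
  exists p; repeat split.
  - exact (og_comp GP ly l2 hp hv).
  - rewrite (ran_comp GC hp). exact ey.
  - now apply (comp_assoc GC w hu hp). }
split; [apply key|].
intro hw. destruct (pseudoproduct_ex h3) as [w' hw'].
now rewrite (pseudoproduct_fun h4 hw (key _ hw')).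
Qed.

Record R_arr := RArr {
  R_fst : G;
  R_snd : G;
  R_snd_id : is_identity R_snd;
  R_le : le (dom R_fst) R_snd
}.

Lemma R_arr_eq p q : R_fst p = R_fst q -> R_snd p = R_snd q -> p = q.
Proof.
destruct p, q; simpl; intros; subst; f_equal; apply proof_irrelevance.
Qed.

Lemma R_id_subproof (e : G) : is_identity e -> le (dom e) e.
Proof. intro h; rewrite h; apply og_le_refl. Qed.

Definition R_id (e : G) (ide : is_identity e) : R_arr :=
  RArr ide (R_id_subproof ide).

Definition R_cat_data : cat_data :=
  @CatData R_arr
    (fun p => R_id (R_snd_id p))
    (fun p => R_id (e := ran (R_fst p)) (dom_ran GC _))
    (fun p q s => R_snd p = ran (R_fst q) /\
       pseudoproduct (R_fst p) (R_fst q) (R_fst s) /\ R_snd s = R_snd q).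

Lemma R_cat_le (p q : R_arr) : R_snd p = ran (R_fst q) ->
  le (dom (R_fst p)) (ran (R_fst q)).
Proof. intros <-; apply R_le. Qed.

Lemma identity_ran (e : G) : is_identity e -> ran e = e.
Proof. intro h; rewrite <- h; apply (ran_dom GC). Qed.

Lemma R_cat_is_category : is_category R_cat_data.
Proof.
split; simpl.
- intros x y z z' [h1 [h2 h3]] [h1' [h2' h3']]. apply R_arr_eq; [|congruence].
  exact (pseudoproduct_fun (R_cat_le h1) h2 h2').
- intros x y; split.
  + intros [z [h _]]. now apply R_arr_eq.
  + intro h. assert (h1 : R_snd x = ran (R_fst y)) by exact (f_equal R_snd h).
    destruct (pseudoproduct_ex (R_cat_le h1)) as [z hz].
    exists (RArr (R_snd_id y) (og_le_trans (pseudoproduct_dom hz) (R_le y))).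
    now simpl.
- intro x; now apply R_arr_eq.
- intro x; apply R_arr_eq; simpl; apply identity_ran, R_snd_id.
- intro x; now apply R_arr_eq.
- intro x; apply R_arr_eq; simpl; apply (ran_ran GC).
- intro x; repeat split.
  + symmetry; apply identity_ran, R_snd_id.
  + assert (h : le (dom (R_fst x)) (ran (R_snd x)))
      by (rewrite (identity_ran (R_snd_id x)); apply R_le).
    apply (pseudoproduct_le _ h). exists (dom (R_fst x)); repeat split.
    * apply R_le.
    * apply (ran_dom GC).
    * apply (comp_dom GC).
- intro x; repeat split.
  assert (h : le (dom (ran (R_fst x))) (ran (R_fst x)))
    by (rewrite (dom_ran GC); apply og_le_refl).
  apply (pseudoproduct_le _ h). exists (R_fst x); repeat split.
  + apply og_le_refl.
  + now rewrite (dom_ran GC).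
  + apply (comp_ran GC).
- intros x y z [_ [_ h]]. now apply R_arr_eq.
- intros x y z [h1 [h2 _]].
  apply R_arr_eq; simpl; apply (pseudoproduct_ran (R_cat_le h1) h2).
- intros x y z u v w [h1 [h2 h3]] [k1 [k2 k3]].
  assert (a := pseudoproduct_assoc (R_fst w) (R_cat_le h1) (R_cat_le k1) h2 k2).
  assert (b := pseudoproduct_ran (R_cat_le k1) k2).
  split; intros [l1 [l2 l3]]; (split; [congruence|]);
    (split; [now apply a | congruence]).
Qed.

Definition R_cat : category := Category R_cat_is_category.

Record R_pair := RPair {
  R_left : G;
  R_right : G;
  R_pair_ran : ran R_left = ran R_right
}.

Lemma R_pair_eq p q : R_left p = R_left q -> R_right p = R_right q -> p = q.
Proof.
destruct p, q; simpl; intros; subst; f_equal; apply proof_irrelevance.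
Qed.

Definition R_gpd_data : cat_data :=
  @CatData R_pair
    (fun p => RPair (eq_refl (ran (R_right p))))
    (fun p => RPair (eq_refl (ran (R_left p))))
    (fun p q s => R_right p = R_left q /\
       R_left s = R_left p /\ R_right s = R_right q).

Lemma R_gpd_is_principal_groupoid : is_principal_groupoid R_gpd_data.
Proof.
split; [split|]; [split|..]; simpl.
- intros x y z z' [_ [h1 h2]] [_ [h1' h2']]; apply R_pair_eq; congruence.
- intros x y; split.
  + intros [z [h _]]; now apply R_pair_eq.
  + intro h; assert (h1 : R_right x = R_left y) by exact (f_equal R_left h).
    assert (h2 : ran (R_left x) = ran (R_right y))
      by (rewrite (R_pair_ran x), h1; apply R_pair_ran).
    now exists (RPair h2).
- reflexivity.
- reflexivity.
- reflexivity.
- reflexivity.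
- now intro x.
- now intro x.
- intros x y z [_ [_ h]]; now apply R_pair_eq.
- intros x y z [_ [h _]]; now apply R_pair_eq.
- intros x y z u v w [h1 [h2 h3]] [k1 [k2 k3]].
  split; intros [l1 [l2 l3]]; repeat split; congruence.
- intro x; now exists (RPair (eq_sym (R_pair_ran x))).
- intros x y h1 h2; apply R_pair_eq.
  + exact (f_equal R_left h2).
  + exact (f_equal R_left h1).
Qed.

Definition R_gpd : principal_groupoid :=
  PrincipalGroupoid R_gpd_is_principal_groupoid.

Lemma R_proj_subproof (p : R_pair) :
  le (dom (ran (R_left p))) (ran (R_right p)).
Proof. rewrite (dom_ran GC), R_pair_ran; apply og_le_refl. Qed.

Definition R_proj (p : R_gpd) : R_cat :=
  RArr (dom_ran GC (R_right p)) (R_proj_subproof p).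

Definition R_act (a : R_cat) (p q : R_gpd) : Prop :=
  R_snd a = ran (R_left p) /\ R_snd a = ran (R_right p) /\
  pseudoproduct (R_fst a) (R_left p) (R_left q) /\
  pseudoproduct (R_fst a) (R_right p) (R_right q).

Lemma R_act_le (a : R_cat) (x : G) : R_snd a = ran x -> le (dom (R_fst a)) (ran x).
Proof. intros <-; apply R_le. Qed.

Lemma pseudoproduct_ran_l (x : G) e : e = ran x -> pseudoproduct e x x.
Proof.
intros ->.
assert (h : le (dom (ran x)) (ran x))
  by (rewrite (dom_ran GC); apply og_le_refl).
apply (pseudoproduct_le _ h). exists x; repeat split.
- apply og_le_refl.
- now rewrite (dom_ran GC).
- apply (comp_ran GC).
Qed.

Definition R_action : action R_cat R_gpd.
Proof.
apply (@Action R_cat R_gpd R_proj R_act).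
- intro x; apply R_arr_eq; simpl; [symmetry; apply R_pair_ran | reflexivity].
- intro x; apply R_arr_eq; simpl; [symmetry; apply R_pair_ran | reflexivity].
- intro x; apply R_arr_eq; simpl; [reflexivity | apply R_pair_ran].
- intros a x y y' [h1 [h2 [h3 h4]]] [k1 [k2 [k3 k4]]]; apply R_pair_eq.
  + exact (pseudoproduct_fun (R_act_le h1) h3 k3).
  + exact (pseudoproduct_fun (R_act_le h2) h4 k4).
- intros a x; split.
  + intros [y [h1 [h2 _]]]; now apply R_arr_eq.
  + intro h. assert (h2 : R_snd a = ran (R_right x)) by exact (f_equal R_snd h).
    assert (h1 : R_snd a = ran (R_left x)) by now rewrite R_pair_ran.
    destruct (pseudoproduct_ex (R_act_le h1)) as [u hu].
    destruct (pseudoproduct_ex (R_act_le h2)) as [v hv].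
    assert (e : ran u = ran v).
    { rewrite (pseudoproduct_ran (R_act_le h1) hu).
      symmetry; exact (pseudoproduct_ran (R_act_le h2) hv). }
    now exists (RPair e).
- intro x; repeat split; simpl.
  + symmetry; apply R_pair_ran.
  + now apply pseudoproduct_ran_l.
  + apply pseudoproduct_ran_l, R_pair_ran.
- intros a x y [h1 [h2 [h3 h4]]]; apply R_arr_eq; simpl.
  + exact (pseudoproduct_ran (R_act_le h1) h3).
  + exact (pseudoproduct_ran (R_act_le h2) h4).
- intros a b c x y z [h1 [h2 h3]] [k1 [k2 [k3 k4]]].
  assert (a1 := pseudoproduct_assoc (R_left z) (R_cat_le h1) (R_act_le k1) h2 k3).
  assert (a2 := pseudoproduct_assoc (R_right z) (R_cat_le h1) (R_act_le k2) h2 k4).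
  assert (b1 := pseudoproduct_ran (R_act_le k1) k3).
  assert (b2 := pseudoproduct_ran (R_act_le k2) k4).
  split; intros [l1 [l2 [l3 l4]]];
    (split; [congruence|]); (split; [congruence|]);
    (split; [now apply a1 | now apply a2]).
- intros a x y [h1 [h2 [h3 h4]]]; now repeat split.
- intros a x y [h1 [h2 [h3 h4]]]; now repeat split.
- intros a x y z x' y' z' [c1 [c2 c3]]
    [h1 [h2 [h3 h4]]] [k1 [k2 [k3 k4]]] [l1 [l2 [l3 l4]]].
  rewrite c2 in l3; rewrite c3 in l4; rewrite <- c1 in k1, k3.
  repeat split.
  + exact (pseudoproduct_fun (R_act_le h2) h4 k3).
  + exact (pseudoproduct_fun (R_act_le h1) l3 h3).
  + exact (pseudoproduct_fun (R_act_le k2) l4 k4).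
Defined.

End Constructions.

(* Main.v *)
(** The class of [(x, y)] is determined by the quotient [x^-1 y]: one has
    [(x, y) = g . (x', y')] for some [g] iff [x^-1 y <= x'^-1 y'].  As every [z]
    is the quotient of [(ran z, z)], and composing pairs multiplies quotients,
    [z |-> [(ran z, z)]] is an isomorphism from [G] onto the quotient, and the
    axioms of an ordered groupoid are transported along it. *)
From Stdlib Require Import Relations IndefiniteDescription.
Require Import Defs.

(** * Cancellation and division in groupoids *)

Lemma inverse_comp_l (G : cat_data) : is_category G -> forall x x' t y : G,
  is_inverse x x' -> comp x t y -> comp x' y t.
Proof.
intros GC x x' t y [h1 _] h.
apply (comp_assoc GC t h1 h).
assert (e : dom x = ran t) by (apply (comp_ex GC); now exists y).
rewrite e; apply (comp_ran GC).
Qed.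

Lemma comp_cancel_l (G : cat_data) : is_groupoid G -> forall x t t' y : G,
  comp x t y -> comp x t' y -> t = t'.
Proof.
intros [GC Ginv] x t t' y h h'.
destruct (Ginv x) as [x' hx].
exact (comp_fun GC (inverse_comp_l _ GC _ _ _ _ hx h)
  (inverse_comp_l _ GC _ _ _ _ hx h')).
Qed.

(** The solution is [t] $= x^{-1}y$, and reassociating through $xx^{-1}$ gives $xt = y$. *)
Lemma groupoid_div_l (G : cat_data) : is_groupoid G -> forall x y : G,
  ran x = ran y -> exists t, comp x t y.
Proof.
intros [GC Ginv] x y e.
destruct (Ginv x) as [x' [h1 h2]].
assert (d : dom x' = ran y)
  by (rewrite <- (dom_comp GC h2), (dom_ran GC); exact e).
apply (comp_ex GC) in d; destruct d as [t ht].
exists t. apply (comp_assoc GC y h2 ht). rewrite e; apply (comp_ran GC).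
Qed.

Lemma groupoid_div_r (G : cat_data) : is_groupoid G -> forall x y : G,
  dom x = dom y -> exists g, comp g x y.
Proof.
intros [GC Ginv] x y e.
destruct (Ginv x) as [x' [h1 h2]].
assert (d : dom y = ran x')
  by (rewrite <- (ran_comp GC h1), (ran_dom GC); now symmetry).
apply (comp_ex GC) in d; destruct d as [g hg].
exists g. apply (comp_assoc GC y hg h1). rewrite e; apply (comp_dom GC).
Qed.

(** Here $t = x^{-1}y$ and $t' = x'^{-1}y'$, and both inversion and the product are monotone. *)
Lemma og_le_div (G : ordered_groupoid) (x y t x' y' t' : G) :
  comp x t y -> comp x' t' y' -> le x x' -> le y y' -> le t t'.
Proof.
intros h h' lx ly.
destruct (ordered_groupoidP G) as [[GC Ginv] _ Ginvle Gcomp _ _].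
destruct (Ginv x) as [u hu], (Ginv x') as [u' hu'].
exact (Gcomp _ _ _ _ _ _ (Ginvle _ _ _ _ hu hu' lx) ly
  (inverse_comp_l _ GC _ _ _ _ hu h) (inverse_comp_l _ GC _ _ _ _ hu' h')).
Qed.

(** * Transport of the ordered groupoid axioms along a structure-reflecting surjection *)

Section Transport.
Variables (G : ordered_groupoid) (K : ordered_data) (g : G -> K).
Hypothesis g_surj : forall X, exists x, X = g x.
Hypothesis g_le : forall x y, le (g x) (g y) <-> le x y.
Hypothesis g_dom : forall x, dom (g x) = g (dom x).
Hypothesis g_ran : forall x, ran (g x) = g (ran x).
Hypothesis g_comp : forall x y z, comp (g x) (g y) (g z) <-> comp x y z.

Let GP := ordered_groupoidP G.
Let GC : is_category G := proj1 (og_groupoid GP).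

(** Injectivity comes from the order: [g] reflects [le], and [le] is antisymmetric on [G]. *)
Lemma transport_inj x y : g x = g y -> x = y.
Proof.
intro h. apply (ord_antisym _ _ (og_order GP)); apply g_le; rewrite h;
  apply g_le, og_le_refl.
Qed.

Lemma transport_inverse x x' : is_inverse (g x) (g x') <-> is_inverse x x'.
Proof.
unfold is_inverse; rewrite g_dom, g_ran, !g_comp; reflexivity.
Qed.

(** By surjectivity every element of [K] is some [g x]; the equivalences then turn each axiom into
    the same axiom of [G]. *)
Lemma transport_is_category : is_category K.
Proof.
split.
- intros X Y Z Z'.
  destruct (g_surj X) as [x ->], (g_surj Y) as [y ->],
    (g_surj Z) as [z ->], (g_surj Z') as [z' ->].
  rewrite !g_comp; intros h h'; f_equal; exact (comp_fun GC h h').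
- intros X Y; destruct (g_surj X) as [x ->], (g_surj Y) as [y ->].
  rewrite g_dom, g_ran; split.
  + intros [Z h]; destruct (g_surj Z) as [z ->]; apply g_comp in h.
    f_equal; apply (comp_ex GC); now exists z.
  + intro h; apply transport_inj, (comp_ex GC) in h; destruct h as [z hz].
    exists (g z); now apply g_comp.
- intro X; destruct (g_surj X) as [x ->].
  now rewrite !g_dom, (dom_dom GC).
- intro X; destruct (g_surj X) as [x ->].
  now rewrite g_dom, g_ran, (ran_dom GC).
- intro X; destruct (g_surj X) as [x ->].
  now rewrite g_ran, g_dom, (dom_ran GC).
- intro X; destruct (g_surj X) as [x ->].
  now rewrite !g_ran, (ran_ran GC).
- intro X; destruct (g_surj X) as [x ->].
  rewrite g_dom; apply g_comp, (comp_dom GC).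
- intro X; destruct (g_surj X) as [x ->].
  rewrite g_ran; apply g_comp, (comp_ran GC).
- intros X Y Z.
  destruct (g_surj X) as [x ->], (g_surj Y) as [y ->], (g_surj Z) as [z ->].
  rewrite g_comp, !g_dom; intro h; f_equal; exact (dom_comp GC h).
- intros X Y Z.
  destruct (g_surj X) as [x ->], (g_surj Y) as [y ->], (g_surj Z) as [z ->].
  rewrite g_comp, !g_ran; intro h; f_equal; exact (ran_comp GC h).
- intros X Y Z U V W.
  destruct (g_surj X) as [x ->], (g_surj Y) as [y ->], (g_surj Z) as [z ->],
    (g_surj U) as [u ->], (g_surj V) as [v ->], (g_surj W) as [w ->].
  rewrite !g_comp; apply (comp_assoc GC).
Qed.

Lemma transport_is_ordered_groupoid : is_ordered_groupoid K.
Proof.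
split.
- split; [exact transport_is_category|].
  intro X; destruct (g_surj X) as [x ->].
  destruct (proj2 (og_groupoid GP) x) as [x' hx].
  exists (g x'); now apply transport_inverse.
- split.
  + intro X; destruct (g_surj X) as [x ->]; apply g_le, og_le_refl.
  + intros X Y Z.
    destruct (g_surj X) as [x ->], (g_surj Y) as [y ->], (g_surj Z) as [z ->].
    rewrite !g_le; apply og_le_trans.
  + intros X Y; destruct (g_surj X) as [x ->], (g_surj Y) as [y ->].
    rewrite !g_le; intros h h'; f_equal.
    exact (ord_antisym _ _ (og_order GP) _ _ h h').
- intros X Y X' Y'.
  destruct (g_surj X) as [x ->], (g_surj Y) as [y ->],
    (g_surj X') as [x' ->], (g_surj Y') as [y' ->].
  rewrite !transport_inverse, !g_le; apply (og_inv GP).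
- intros X Y U V P Q.
  destruct (g_surj X) as [x ->], (g_surj Y) as [y ->],
    (g_surj U) as [u ->], (g_surj V) as [v ->],
    (g_surj P) as [p ->], (g_surj Q) as [q ->].
  rewrite !g_comp, !g_le; apply (og_comp GP).
- intros X E; destruct (g_surj X) as [x ->], (g_surj E) as [e ->].
  unfold is_identity, is_restriction; rewrite !g_dom, g_le.
  intros ide l; apply transport_inj in ide.
  destruct (og_restr GP ide l) as [u [[lu du] hu]].
  exists (g u); split.
  + rewrite g_le, g_dom; split; [exact lu | now f_equal].
  + intros V; destruct (g_surj V) as [v ->].
    rewrite g_le, g_dom; intros [lv dv]; f_equal.
    apply hu; split; [exact lv | now apply transport_inj].
- intros X E; destruct (g_surj X) as [x ->], (g_surj E) as [e ->].
  unfold is_identity, is_corestriction; rewrite g_dom, g_ran, !g_le.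
  intros ide l; apply transport_inj in ide.
  destruct (og_corestr GP ide l) as [u [[lu ru] hu]].
  exists (g u); split.
  + rewrite g_le, g_ran; split; [exact lu | now f_equal].
  + intros V; destruct (g_surj V) as [v ->].
    rewrite g_le, g_ran; intros [lv rv]; f_equal.
    apply hu; split; [exact lv | now apply transport_inj].
Qed.

Lemma transport_isomorphic : isomorphic K G.
Proof.
(* Surjectivity only asserts that preimages exist; choice turns this into a function [f], a
   two-sided inverse of [g] by injectivity. *)
destruct (functional_choice (fun X x => X = g x) g_surj) as [f hf].
assert (fg : forall x, f (g x) = x)
  by (intro x; symmetry; apply transport_inj, hf).
exists f, g; split; [|split; [|split; [|split; [|split]]]].
- intro X; symmetry; apply hf.
- exact fg.
- split.
  + intro X; rewrite (hf X), g_dom, !fg; reflexivity.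
  + intro X; rewrite (hf X), g_ran, !fg; reflexivity.
  + intros X Y Z h; apply g_comp; now rewrite <- !hf.
- intros X Y h; apply g_le; now rewrite <- !hf.
- split; intros; [symmetry; apply g_dom | symmetry; apply g_ran |].
  now apply g_comp.
- intros x y h; now apply g_le.
Qed.
End Transport.

(** * Classes of pairs and their quotients *)

Section Quotient.
Variable G : ordered_groupoid.

Let GP := ordered_groupoidP G.
Let GG : is_groupoid G := og_groupoid GP.
Let GC : is_category G := proj1 GG.

(** [quotient p z] says [z = x^-1 y] for [p = (x, y)], without mentioning
    inverses. *)
Definition quotient (p : R_gpd G) (z : G) : Prop :=
  comp (R_left p) z (R_right p).

Lemma quotient_ex (p : R_gpd G) : exists z, quotient p z.
Proof. apply (groupoid_div_l _ GG), R_pair_ran. Qed.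

(** Acting by $(g,e)$ first corestricts both components to range $\mathbf{d}(g)$, which can only
    lower the quotient, and then multiplies both on the left by $g$, which leaves it unchanged.
    Conversely, uniqueness of restrictions shows that every element below [w] arises in this way. *)
Lemma act_le_quotient (p q : R_gpd G) (z w : G) :
  quotient p z -> quotient q w -> (act_le (R_action G) p q <-> le z w).
Proof.
unfold quotient; intros hz hw; split.
- intros [a [h1 [h2 [h3 h4]]]].
  apply (pseudoproduct_le _ (R_act_le h1)) in h3; destruct h3 as [v [lv [ev hv]]].
  apply (pseudoproduct_le _ (R_act_le h2)) in h4; destruct h4 as [u [lu [eu hu]]].
  destruct (groupoid_div_l _ GG v u) as [t ht]; [congruence|].
  (* With $g$ the first component of [a], the left and right components of [p] are $gv$ and $gu$, so
     the factor $g$ cancels and $v^{-1}u$ is also the quotient of [p]. *)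
  assert (z = t) as ->.
  { apply (comp_cancel_l _ GG _ _ _ _ hz).
    exact (proj2 (comp_assoc GC _ hv ht) hu). }
  exact (og_le_div _ _ _ _ _ _ _ ht hw lv lu).
- intro l.
  assert (dz := dom_comp GC hz); assert (dw := dom_comp GC hw).
  (* The pair [(v, u)] below [q] is chosen so that its quotient has domain [dom z]; this quotient
     lies below [w], hence equals [z]. *)
  destruct (og_restr GP (x := R_right q) (e := dom z) (dom_dom GC z))
    as [u [[lu du] _]].
  { rewrite dw; now apply og_le_dom. }
  destruct (og_corestr GP (x := R_left q) (e := ran u) (dom_ran GC u))
    as [v [[lv rv] _]].
  { rewrite (R_pair_ran q); now apply og_le_ran. }
  destruct (groupoid_div_l _ GG v u rv) as [t ht].
  assert (t = z) as ->.
  { apply (og_restriction_eq (x := w)); [|exact l|].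
    - exact (og_le_div _ _ _ _ _ _ _ ht hw lv lu).
    - now rewrite <- (dom_comp GC ht). }
  (* The acting element is $g = av^{-1}$, with $a$ the left component of [p]. It also carries [u] to
     the right component, since $gu = gvz = az$. *)
  destruct (groupoid_div_r _ GG v (R_left p)) as [g hg].
  { transitivity (ran z); [|symmetry]; apply (comp_ex GC); eauto. }
  assert (hg' := proj1 (comp_assoc GC _ hg ht) hz).
  assert (dg : dom g = ran v) by (apply (comp_ex GC); eauto).
  assert (lg : le (dom g) (ran (R_left q)))
    by (rewrite dg; now apply og_le_ran).
  exists (RArr (dom_ran GC (R_left q)) lg : R_cat G).
  assert (lg' := lg); rewrite R_pair_ran in lg'.
  split; [|split; [|split]]; simpl.
  + reflexivity.
  + apply R_pair_ran.
  + apply (pseudoproduct_le _ lg); now exists v.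
  + apply (pseudoproduct_le _ lg'); exists u; repeat split; congruence.
Qed.

Lemma act_equiv_quotient (p q : R_gpd G) (z : G) :
  quotient q z -> (act_equiv (R_action G) p q <-> quotient p z).
Proof.
intro hq; split.
- intros [h1 h2]. destruct (quotient_ex p) as [w hp].
  apply (act_le_quotient _ _ _ _ hp hq) in h1.
  apply (act_le_quotient _ _ _ _ hq hp) in h2.
  now rewrite <- (ord_antisym _ _ (og_order GP) _ _ h1 h2).
- intro hp; split.
  + apply (act_le_quotient _ _ _ _ hp hq), og_le_refl.
  + apply (act_le_quotient _ _ _ _ hq hp), og_le_refl.
Qed.

Definition unit_pair (z : G) : R_gpd G := RPair (ran_ran GC z).

Lemma quotient_unit_pair z : quotient (unit_pair z) z.
Proof. apply (comp_ran GC). Qed.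

Definition J_of (z : G) : J (R_action G) := class_of _ (unit_pair z).

Lemma class_of_quotient p z : quotient p z -> class_of (R_action G) p = J_of z.
Proof.
intro h; apply class_of_eq.
now apply (act_equiv_quotient _ _ _ (quotient_unit_pair z)).
Qed.

Lemma J_of_surj X : exists z, X = J_of z.
Proof.
destruct (class_of_surj X) as [p ->], (quotient_ex p) as [z h].
exists z; now apply class_of_quotient.
Qed.

Lemma le_J_of x y : le (J_of x) (J_of y) <-> le x y.
Proof.
unfold J_of; rewrite le_class_of.
apply act_le_quotient; apply quotient_unit_pair.
Qed.

(** The domain of the pair [(ran x, x)] is [(x, x)], whose quotient is [dom x]. *)
Lemma dom_J_of x : dom (J_of x) = J_of (dom x).
Proof.
unfold J_of at 1; rewrite dom_class_of.
apply class_of_quotient, (comp_dom GC).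
Qed.

Lemma ran_J_of x : ran (J_of x) = J_of (ran x).
Proof.
unfold J_of at 1; rewrite ran_class_of; apply class_of_quotient.
unfold quotient; simpl. rewrite <- (ran_ran GC x) at 1; apply (comp_ran GC).
Qed.

Lemma comp_J_of x y z : comp (J_of x) (J_of y) (J_of z) <-> comp x y z.
Proof.
split.
- intros [p [q [r [hp [hq [[c1 [c2 c3]] hr]]]]]].
  apply (act_equiv_quotient _ _ _ (quotient_unit_pair x)) in hp.
  apply (act_equiv_quotient _ _ _ (quotient_unit_pair y)) in hq.
  symmetry in hr; apply class_of_eq in hr.
  apply (act_equiv_quotient _ _ _ (quotient_unit_pair z)) in hr.
  unfold quotient in hp, hq, hr; rewrite c2, c3 in hr; rewrite <- c1 in hq.
  (* For composable pairs $(a,b)$ and $(b,c)$ with quotients [x] and [y], both [z] and the product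
     $xy$ solve $at = c$, so they agree by cancellation. *)
  assert (d : dom x = ran y).
  { rewrite <- (dom_comp GC hp); apply (comp_ex GC); eauto. }
  apply (comp_ex GC) in d; destruct d as [t ht].
  apply (comp_assoc GC _ hp ht) in hq.
  now rewrite (comp_cancel_l _ GG _ _ _ _ hr hq).
- intro h; assert (e := ran_comp GC h).
  assert (hr : ran (ran x) = ran z) by (rewrite (ran_ran GC); now symmetry).
  (* The pairs are [(ran x, x)], [(x, z)] and their product [(ran x, z)]. The middle one replaces
     [unit_pair y], which need not be composable with [unit_pair x]; its quotient is [y] because $xy
     = z$. *)
  exists (unit_pair x), (RPair (eq_sym e)), (RPair hr).
  split; [|split; [|split]].
  + now apply (act_equiv_quotient _ _ _ (quotient_unit_pair x)),
      quotient_unit_pair.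
  + now apply (act_equiv_quotient _ _ _ (quotient_unit_pair y)).
  + now repeat split.
  + symmetry; apply class_of_quotient.
    unfold quotient; simpl; rewrite <- e; apply (comp_ran GC).
Qed.
End Quotient.

Theorem theorem4p4 (G : ordered_groupoid) :
  is_ordered_groupoid (J (R_action G)) /\ isomorphic (J (R_action G)) G.
Proof.
split.
- exact (transport_is_ordered_groupoid _ _ _ (J_of_surj G) (le_J_of G)
    (dom_J_of G) (ran_J_of G) (comp_J_of G)).
- exact (transport_isomorphic _ _ _ (J_of_surj G) (le_J_of G)
    (dom_J_of G) (ran_J_of G) (comp_J_of G)).
Qed.
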